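(* Let $K=\{\lambda\in\mathbb{R}^{n_\lambda}\mid g(\lambda)\ge 0\}$ be a nonempty closed convex set, where $g:\mathbb{R}^{n_\lambda}\to\mathbb{R}^{n_g}$ is continuously differentiable with concave components, with LICQ holding at every point of $K$; let $F:\mathbb{R}^{n_x}\times\mathbb{R}^{n_u}\times\mathbb{R}^{n_\lambda}\to\mathbb{R}^{n_\lambda}$ be $LC^2$; let $d:\mathbb{R}^{n_\lambda}\to\mathbb{R}$ be strongly convex and $LC^3$; and let $c>0$ and $b>a>0$. Then for every $(x,u,\lambda)\in\mathbb{R}^{n_x}\times\mathbb{R}^{n_u}\times\mathbb{R}^{n_\lambda}$ the following are equivalent: (1) $\lambda\in\mathrm{SOL}(K,F(x,u,\lambda))$; (2) there is $\eta\in\mathbb{R}^{n_\lambda}$ such that $F(x,u,\lambda)-\eta=0$, $g(\lambda)\ge 0$ and $\varphi^c_{Au}(\lambda,\eta)\le 0$; (3) there is $\eta\in\mathbb{R}^{n_\lambda}$ such that $F(x,u,\lambda)-\eta=0$ and $\varphi^{ab}_{Au}(\lambda,\eta)\le 0$.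
   Context: Gradients of scalar functions are row vectors. A function is $LC^k$ if its $k$-th derivative exists and is Lipschitz continuous. LICQ at $\lambda\in K$: the vectors $\nabla_\lambda g_i(\lambda)$ with $g_i(\lambda)=0$ are linearly independent. $\lambda\in\mathrm{SOL}(K,F(x,u,\lambda))$ means that $\lambda\in K$ and $(\omega-\lambda)^TF(x,u,\lambda)\ge 0$ for all $\omega\in K$. Gap functions: for $c>0$, Auchmuty's function is $$L^c_{Au}(\lambda,\eta,\omega)=c\,d(\lambda)-c\,d(\omega)+(\eta^T-c\nabla_\lambda d(\lambda))(\lambda-\omega),\qquad \lambda,\eta,\omega\in\mathbb{R}^{n_\lambda}.$$ The generalized primal gap function is $\varphi^c_{Au}(\lambda,\eta)=\sup_{\omega\in K}L^c_{Au}(\lambda,\eta,\omega)$. For $b>a>0$ the generalized D-gap function is $\varphi^{ab}_{Au}(\lambda,\eta)=\varphi^a_{Au}(\lambda,\eta)-\varphi^b_{Au}(\lambda,\eta)$. *)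

(* Defs.v *)
From HB Require Import structures.
From mathcomp Require Import all_boot all_order all_algebra.
From mathcomp Require Import all_classical all_reals all_analysis.

Set Implicit Arguments.
Unset Strict Implicit.
Unset Printing Implicit Defensive.

Import Order.TTheory GRing.Theory Num.Theory.
Import numFieldNormedType.Exports.

Local Open Scope classical_set_scope.
Local Open Scope ring_scope.

(* Points of R^n are column vectors and gradients are row vectors. The library
   norm on matrices is the max norm; differentiability, closedness and the
   existence of a Lipschitz constant do not depend on the choice of the norm. *)

Definition dotv (R : realType) (n : nat) (u v : 'cV[R]_n) : R :=
  (u^T *m v) 0 0.

Definition grad (R : realType) (n : nat) (f : 'cV[R]_n -> R) (x : 'cV[R]_n) :
    'rV[R]_n :=
  \row_j 'd f x (delta_mx j 0).

(* The library's [jacobian] acts on row vectors; this is its column version. *)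
Definition Jac (R : realType) (n m : nat) (f : 'cV[R]_n -> 'cV[R]_m)
    (x : 'cV[R]_n) : 'M[R]_(m, n) :=
  \matrix_(i, j) 'd f x (delta_mx j 0) i 0.

Definition C1 (R : realType) (n m : nat) (f : 'cV[R]_n -> 'cV[R]_m) : Prop :=
  (forall x, differentiable f x) /\ continuous (Jac f).

(* The k-th derivative exists and is (globally) Lipschitz continuous. The
   derivative of f : R^n -> R^m is read as the map x |-> Jac f x into
   R^(m * n), the matrix being flattened so that it can be differentiated
   again. *)
Fixpoint LC (R : realType) (n k m : nat) (f : 'cV[R]_n -> 'cV[R]_m) : Prop :=
  match k with
  | 0 => lipschitz f
  | k'.+1 => (forall x, differentiable f x) /\
             LC k' (fun x => (mxvec (Jac f x))^T)
  end.

(* With respect to the Euclidean norm. *)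
Definition strongly_convex (R : realType) (n : nat) (f : 'cV[R]_n -> R) : Prop :=
  exists2 mu : R, 0 < mu &
    forall (x y : 'cV[R]_n) (t : R), 0 <= t <= 1 ->
      f (t *: x + (1 - t) *: y) <=
      t * f x + (1 - t) * f y
        - mu / 2%:R * t * (1 - t) * dotv (x - y) (x - y).

Definition concave (R : realType) (n : nat) (f : 'cV[R]_n -> R) : Prop :=
  convex_function (setT : set (convex_lmodType 'cV[R]_n)) (fun x => - f x).

Definition nonneg_set (R : realType) (n m : nat) (g : 'cV[R]_n -> 'cV[R]_m) :
    set 'cV[R]_n :=
  [set lam | forall i, 0 <= g lam i 0].

(* [free] is applied to the family of active gradients, so that a repeated
   gradient counts as a linear dependence. *)
Definition LICQ (R : realType) (n m : nat) (g : 'cV[R]_n -> 'cV[R]_m)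
    (lam : 'cV[R]_n) : Prop :=
  free [seq grad (fun y => g y i 0) lam | i <- enum 'I_m & g lam i 0 == 0].

Definition SOL (R : realType) (n : nat) (K : set 'cV[R]_n)
    (G : 'cV[R]_n -> 'cV[R]_n) : set 'cV[R]_n :=
  [set lam | K lam /\ forall omega, K omega -> 0 <= dotv (omega - lam) (G lam)].

Definition L_Au (R : realType) (n : nat) (d : 'cV[R]_n -> R) (c : R)
    (lam eta omega : 'cV[R]_n) : R :=
  c * d lam - c * d omega
    + ((eta^T - c *: grad d lam) *m (lam - omega)) 0 0.

(* The supremum is taken in the extended reals. It is finite when K is nonempty
   and closed, d is strongly convex and c > 0, so the difference in
   [phi_Au_ab] is then an ordinary difference of reals. *)
Definition phi_Au (R : realType) (n : nat) (K : set 'cV[R]_n)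
    (d : 'cV[R]_n -> R) (c : R) (lam eta : 'cV[R]_n) : \bar R :=
  ereal_sup [set (L_Au d c lam eta omega)%:E | omega in K].

Definition phi_Au_ab (R : realType) (n : nat) (K : set 'cV[R]_n)
    (d : 'cV[R]_n -> R) (a b : R) (lam eta : 'cV[R]_n) : \bar R :=
  (phi_Au K d a lam eta - phi_Au K d b lam eta)%E.

(* Main.v *)
(* With D(w) = d(w) - d(lam) - grad d(lam) (w - lam) the Bregman distance, the
   Auchmuty function is L^c(w) = - eta.(w - lam) - c D(w). Strong convexity makes
   D quadratically coercive, and differentiability makes D(lam + t h) = o(t): so
   for lam in K the condition sup L^c <= 0 on K is the variational inequality,
   whatever c > 0. If phi^a <= phi^b, then a w in K with L^b(w) > phi^b - e has
   phi^b >= phi^a >= L^a(w) = L^b(w) + (b - a) D(w), hence (b - a) D(w) < e;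
   letting e tend to 0 gives lam in K, as K is closed, and phi^b <= 0. *)
Require Import Defs.
From HB Require Import structures.
From mathcomp Require Import all_boot all_order all_algebra.
From mathcomp Require Import all_classical all_reals all_analysis.
From mathcomp Require Import ring lra.

Set Implicit Arguments.
Unset Strict Implicit.
Unset Printing Implicit Defensive.

Import Order.TTheory GRing.Theory Num.Theory.
Import numFieldNormedType.Exports.

Local Open Scope classical_set_scope.
Local Open Scope ring_scope.

(** * Euclidean inner product, compared with the max norm *)

Lemma dotvE (R : realType) (n : nat) (u v : 'cV[R]_n) :
  dotv u v = \sum_i u i 0 * v i 0.
Proof. by rewrite /dotv mxE; apply: eq_bigr => i _; rewrite mxE. Qed.

Lemma dotvC (R : realType) (n : nat) (u v : 'cV[R]_n) : dotv u v = dotv v u.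
Proof. by rewrite !dotvE; apply: eq_bigr => i _; rewrite mulrC. Qed.

Lemma dotvDr (R : realType) (n : nat) (u v w : 'cV[R]_n) :
  dotv u (v + w) = dotv u v + dotv u w.
Proof. by rewrite /dotv mulmxDr mxE. Qed.

Lemma dotvZr (R : realType) (n : nat) (t : R) (u v : 'cV[R]_n) :
  dotv u (t *: v) = t * dotv u v.
Proof. by rewrite /dotv -scalemxAr mxE. Qed.

Lemma dotvNr (R : realType) (n : nat) (u v : 'cV[R]_n) :
  dotv u (- v) = - dotv u v.
Proof. by rewrite -scaleN1r dotvZr mulN1r. Qed.

Lemma dotvv_ge0 (R : realType) (n : nat) (v : 'cV[R]_n) : 0 <= dotv v v.
Proof. by rewrite dotvE; apply: sumr_ge0 => i _; rewrite -expr2 sqr_ge0. Qed.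

(** Expand the squared length of [s *: u - v]. With a suitable [s] this takes the place of
    Cauchy-Schwarz and avoids square roots. *)
Lemma dotv_young (R : realType) (n : nat) (u v : 'cV[R]_n) (s : R) :
  2 * s * dotv u v <= s ^+ 2 * dotv u u + dotv v v.
Proof.
have := dotvv_ge0 (s *: u + - v).
rewrite dotvDr dotvZr dotvNr ![dotv (_ + _) _]dotvC !dotvDr !dotvZr !dotvNr.
rewrite (dotvC v u); nra.
Qed.

(** Each squared coordinate is one of the nonnegative summands of [dotv v v]. This carries Euclidean
    estimates over to the balls of the max norm. *)
Lemma norm_lt_dotv (R : realType) (n : nat) (v : 'cV[R]_n) (e : R) :
  0 < e -> dotv v v < e ^+ 2 -> `|v| < e.
Proof.
move=> e0 ve; have -> : e = (NngNum (ltW e0))%:num by [].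
rewrite [`|v|]mx_normE num_lt; apply/bigmax_ltP; split=> [|[i j] _].
  by rewrite -num_lt.
rewrite -num_lt/= ord1 -(@ltr_pXn2r _ 2) ?nnegrE ?(ltW e0)//.
rewrite real_normK ?num_real//; apply: le_lt_trans ve.
rewrite dotvE (bigD1 i)//= -expr2 lerDl.
by apply: sumr_ge0 => k _; rewrite -expr2 sqr_ge0.
Qed.

(** * Directional derivatives and the Bregman distance *)

Lemma grad_mulmx (R : realType) (n : nat) (f : 'cV[R]_n -> R)
    (x h : 'cV[R]_n) :
  (grad f x *m h) 0 0 = 'd f x h.
Proof.
rewrite mxE [in RHS](matrix_sum_delta h) linear_sum/=.
apply: eq_bigr => i _; rewrite big_ord1 mxE linearZ/=.
by rewrite mulrC.
Qed.

(** Divide by [t] and let [t] tend to 0 from the right: the term with [B] vanishes. It is applied to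
    [d] for strong convexity and to [- d] for the variational inequality. *)
Lemma diff_le_chord (R : realType) (V : normedModType R) (f : V -> R)
    (x h : V) (A B : R) :
  differentiable f x ->
  (forall t, 0 < t <= 1 -> f (x + t *: h) - f x <= t * (A + t * B)) ->
  'd f x h <= A.
Proof.
move=> df fle.
have quot : t^-1 * (f (x + t *: h) - f x) @[t --> (0 : R)^'+] --> 'd f x h.
  rewrite -deriveE//; apply: cvg_dnbhs_at_right.
  under eq_cvg do rewrite [x + _]addrC.
  exact: (@diff_derivable _ _ _ _ _ h df).
have lin : A + t * B @[t --> (0 : R)^'+] --> A.
  rewrite -[X in _ --> X]addr0 -[X in _ + X](mul0r B).
  apply: cvgD; first exact: cvg_cst.
  apply: cvgMl; apply: cvg_at_right_filter; exact: cvg_id.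
apply: (ler_cvg_to quot lin); near=> t.
have t0 : 0 < t by near: t; exact: nbhs_right_gt.
have t1 : t <= 1 by near: t; exact: nbhs_right_le.
by rewrite ler_pdivrMl//; apply: fle; rewrite t0 t1.
Unshelve. all: by end_near. Qed.

Definition bregman (R : realType) (n : nat) (d : 'cV[R]_n -> R)
    (lam omega : 'cV[R]_n) : R :=
  d omega - d lam - 'd d lam (omega - lam).

Lemma L_AuE (R : realType) (n : nat) (d : 'cV[R]_n -> R) (c : R)
    (lam eta omega : 'cV[R]_n) :
  L_Au d c lam eta omega
  = - dotv eta (omega - lam) - c * bregman d lam omega.
Proof.
rewrite /L_Au -(opprB omega lam) mulmxN mulmxBl -scalemxAl.
have -> : (- (eta^T *m (omega - lam) - c *: (grad d lam *m (omega - lam)))) 0 0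
    = - (dotv eta (omega - lam) - c * 'd d lam (omega - lam)).
  rewrite -grad_mulmx /dotv.
  by set u := eta^T *m _; set v := grad d lam *m _; rewrite !mxE.
rewrite /bregman; ring.
Qed.

Lemma L_Au_diag (R : realType) (n : nat) (d : 'cV[R]_n -> R) (c : R)
    (lam eta : 'cV[R]_n) : L_Au d c lam eta lam = 0.
Proof. by rewrite /L_Au !subrr mulmx0 mxE addr0. Qed.

Lemma bregman_ge (R : realType) (n : nat) (d : 'cV[R]_n -> R) (mu : R)
    (lam omega : 'cV[R]_n) :
  differentiable d lam ->
  (forall (x y : 'cV[R]_n) (t : R), 0 <= t <= 1 ->
      d (t *: x + (1 - t) *: y) <=
      t * d x + (1 - t) * d y
        - mu / 2 * t * (1 - t) * dotv (x - y) (x - y)) ->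
  mu / 2 * dotv (omega - lam) (omega - lam) <= bregman d lam omega.
Proof.
move=> dd dsc; rewrite /bregman lerBrDl -lerBrDr.
set q := dotv _ _.
(* The factor [1 - t] in the strong convexity bound splits: its 1 goes into [A], its [- t] gives
   [B]. *)
apply: (@diff_le_chord _ _ d _ _ _ (mu / 2 * q)) => // t /andP[t0 t1].
have := dsc omega lam t; rewrite (ltW t0) t1 => /(_ isT).
rewrite -/q.
have -> : t *: omega + (1 - t) *: lam = lam + t *: (omega - lam).
  by rewrite scalerBr scalerBl scale1r addrCA.
by nra.
Qed.

Lemma LC_differentiable (R : realType) (n k : nat) (d : 'cV[R]_n -> R)
    (x : 'cV[R]_n) :
  LC k.+1 (fun lam => (d lam)%:M : 'cV[R]_1) -> differentiable d x.
Proof.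
move=> [dd _].
have -> : d = (fun N : 'cV[R]_1 => N 0 0) \o (fun lam => (d lam)%:M : 'cV[R]_1).
  by apply/funext => y /=; rewrite mxE eqxx mulr1n.
by apply: differentiable_comp => //; exact: differentiable_coord.
Qed.

(** * The gap function and the variational inequality *)

Lemma VI_phi_Au_le0 (R : realType) (n : nat) (K : set 'cV[R]_n)
    (d : 'cV[R]_n -> R) (c : R) (lam eta : 'cV[R]_n) :
  0 < c -> (forall omega, 0 <= bregman d lam omega) ->
  (forall omega, K omega -> 0 <= dotv eta (omega - lam)) ->
  (phi_Au K d c lam eta <= 0)%E.
Proof.
move=> c0 dge0 vi; apply: ge_ereal_sup => _ [w Kw <-].
have := mulr_ge0 (ltW c0) (dge0 w); have := vi w Kw.
by rewrite lee_fin L_AuE; lra.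
Qed.

Lemma phi_Au_le0_VI (R : realType) (n : nat) (K : set 'cV[R]_n)
    (d : 'cV[R]_n -> R) (c : R) (lam eta : 'cV[R]_n) :
  0 < c -> differentiable d lam ->
  convex_set (K : set (convex_lmodType 'cV[R]_n)) -> K lam ->
  (phi_Au K d c lam eta <= 0)%E ->
  forall omega, K omega -> 0 <= dotv eta (omega - lam).
Proof.
move=> c0 dd cK Kl phi0 w Kw.
have ddN : differentiable (- d) lam by exact: differentiableN.
(* By convexity the segment from [lam] to [w] stays in [K], and [L_Au <= 0] along it bounds the
   chords of [- d]. In the limit the derivative of [d] appears on both sides and cancels, which
   leaves the sign of [dotv eta (w - lam)]. *)
have : 'd (- d) lam (w - lam) <= c^-1 * dotv eta (w - lam) - 'd d lam (w - lam).
  apply: (@diff_le_chord _ _ _ _ _ _ 0) => // t /andP[t0 t1].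
  have Kt : K (lam + t *: (w - lam)).
    have t01 : Itv.spec (@Itv.num_sem R) (Itv.Real `[0, 1]%Z) t.
      by rewrite /= /Itv.num_sem num_real in_itv/= (ltW t0) t1.
    have /set_mem : t *: w + (1 - t) *: lam \in K
      := cK w lam (Itv.mk t01) (mem_set Kw) (mem_set Kl).
    by congr K; rewrite scalerBr scalerBl scale1r addrCA.
  have : L_Au d c lam eta (lam + t *: (w - lam)) <= 0.
    rewrite -lee_fin; apply: le_trans phi0; apply: ereal_sup_ubound.
    by exists (lam + t *: (w - lam)).
  rewrite L_AuE /bregman (addrAC lam) subrr add0r dotvZr.
  have -> : 'd d lam (t *: (w - lam)) = t * 'd d lam (w - lam).
    by rewrite linearZ.
  have Nd y : (- d) y = - d y by [].
  move=> Lle; rewrite !Nd mulr0 addr0 -(ler_pM2l c0).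
  have -> : c * (t * (c^-1 * dotv eta (w - lam) - 'd d lam (w - lam))) =
      t * dotv eta (w - lam) - c * (t * 'd d lam (w - lam)).
    by field; rewrite gt_eqF.
  by lra.
rewrite diffN// -[(- _) _]/(- 'd d lam (w - lam)).
by rewrite -lerBlDr opprK addrC subrr pmulr_rge0 ?invr_gt0.
Qed.

(** * Finiteness of the gap function, and the D-gap function *)

Lemma phi_Au_ge0 (R : realType) (n : nat) (K : set 'cV[R]_n)
    (d : 'cV[R]_n -> R) (c : R) (lam eta : 'cV[R]_n) :
  K lam -> (0 <= phi_Au K d c lam eta)%E.
Proof.
move=> Kl; apply: ereal_sup_ubound; exists lam => //.
by rewrite L_Au_diag.
Qed.

Lemma phi_Au_fin_num (R : realType) (n : nat) (K : set 'cV[R]_n)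
    (d : 'cV[R]_n -> R) (c mu : R) (lam eta : 'cV[R]_n) :
  K !=set0 -> 0 < c -> 0 < mu ->
  (forall omega,
     mu / 2 * dotv (omega - lam) (omega - lam) <= bregman d lam omega) ->
  phi_Au K d c lam eta \is a fin_num.
Proof.
move=> [w0 Kw0] c0 mu0 dge; rewrite fin_numE; apply/andP; split.
  rewrite gt_eqF// (lt_le_trans (ltNyr (L_Au d c lam eta w0)))//.
  by apply: ereal_sup_ubound; exists w0.
rewrite lt_eqF// (le_lt_trans _ (ltry ((c * mu)^-1 / 2 * dotv eta eta)))//.
apply: ge_ereal_sup => _ [w Kw <-]; rewrite lee_fin L_AuE.
have cmu0 : 0 < c * mu by rewrite mulr_gt0.
(* This parameter makes the quadratic term of the Young bound equal to the one that [c * bregman]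
   absorbs; what remains does not depend on [w]. *)
have := dotv_young eta (lam - w) (c * mu)^-1.
have -> : dotv (lam - w) (lam - w) = dotv (w - lam) (w - lam).
  by rewrite -(opprB w lam) dotvNr dotvC dotvNr opprK.
rewrite -(opprB w lam) dotvNr.
have := dge w; rewrite -(ler_pM2l c0).
set q := dotv (w - lam) _; set p := dotv eta _; set N := dotv eta eta.
move=> h1; rewrite -(ler_pM2l cmu0) => h2.
have : c * mu * (2 * (c * mu)^-1 * - p) = - 2 * p.
  by field; rewrite !gt_eqF.
have : c * mu * ((c * mu)^-1 ^+ 2 * N + q) = (c * mu)^-1 * N + c * mu * q.
  by field; rewrite !gt_eqF.
by lra.
Qed.

(** Near-maximizers suffice, so attainment of the supremum need not be shown. Finiteness of the gap
    function for [b] provides them. *)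
Lemma phi_Au_near_maximizer (R : realType) (n : nat) (K : set 'cV[R]_n)
    (d : 'cV[R]_n -> R) (a b e : R) (lam eta : 'cV[R]_n) :
  0 < e -> phi_Au K d b lam eta \is a fin_num ->
  (phi_Au K d a lam eta <= phi_Au K d b lam eta)%E ->
  exists omega, [/\ K omega, (b - a) * bregman d lam omega < e &
    (phi_Au K d b lam eta < (L_Au d b lam eta omega + e)%:E)%E].
Proof.
move=> e0 fb ab; have [_ [w Kw <-]] := ub_ereal_sup_adherent e0 fb.
rewrite -/(phi_Au K d b lam eta) => blt.
have ale : ((L_Au d a lam eta w)%:E <= phi_Au K d b lam eta)%E.
  by apply: le_trans ab; apply: ereal_sup_ubound; exists w.
exists w; move: blt ale; rewrite -(fineK fb) -EFinB !lte_fin !lee_fin.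
by rewrite !L_AuE => h1 h2; split=> //; lra.
Qed.

Lemma phi_Au_ab_le0 (R : realType) (n : nat) (K : set 'cV[R]_n)
    (d : 'cV[R]_n -> R) (a b mu : R) (lam eta : 'cV[R]_n) :
  K !=set0 -> closed K -> 0 < b -> a < b -> 0 < mu ->
  (forall omega,
     mu / 2 * dotv (omega - lam) (omega - lam) <= bregman d lam omega) ->
  (phi_Au_ab K d a b lam eta <= 0)%E ->
  K lam /\ (phi_Au K d b lam eta <= 0)%E.
Proof.
move=> K0 cK b0 ab mu0 dge; rewrite /phi_Au_ab.
have fb : phi_Au K d b lam eta \is a fin_num.
  exact: (@phi_Au_fin_num _ _ _ _ _ mu).
(* Moving the subtracted term across is legitimate in the extended reals because it is finite. *)
rewrite leeBlDr// add0e => gap.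
have M0 : 0 < (b - a) * (mu / 2) by rewrite mulr_gt0 ?subr_gt0 ?divr_gt0.
(* The tolerance is [(b - a) * (mu / 2) * s]: quadratic growth of [bregman] then turns it into
   squared distance below [s]. *)
have near_lam s : 0 < s -> exists omega, [/\ K omega,
    dotv (omega - lam) (omega - lam) < s &
    (phi_Au K d b lam eta <
      (- dotv eta (omega - lam) + (b - a) * (mu / 2) * s)%:E)%E].
  move=> s0; have [w [Kw wlt philt]] :=
    phi_Au_near_maximizer (mulr_gt0 M0 s0) fb gap.
  exists w; split=> //.
    rewrite -(ltr_pM2l M0); apply: le_lt_trans wlt.
    by rewrite -mulrA ler_pM2l ?subr_gt0.
  apply: (lt_le_trans philt); rewrite lee_fin L_AuE lerD2r gerBl.
  rewrite pmulr_rge0//; apply: le_trans (dge w).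
  by rewrite mulr_ge0 ?dotvv_ge0// divr_ge0 ?ltW.
split.
  (* Near-maximizers lie in [K] and in every ball around [lam]. *)
  apply: cK => U /nbhs_ballP[e /= e0 eU].
  have [w [Kw wlt _]] := near_lam (e ^+ 2) (exprn_gt0 _ e0).
  exists w; split=> //; apply: eU; rewrite -ball_normE /=.
  by rewrite distrC; exact: norm_lt_dotv.
apply/lee_addgt0Pr => e e0; rewrite add0e.
(* [C] collects the two errors at squared distance below [s ^+ 2]: the linear term costs at most
   [s * (dotv eta eta + 1)] by Young, and the tolerance at most [(b - a) * (mu / 2) * s] since
   [s <= 1]. Hence [s <= e / C]. *)
set C := dotv eta eta + 1 + (b - a) * (mu / 2).
have C0 : 0 < C by have := dotvv_ge0 eta; rewrite /C; lra.
pose s := Num.min 1 (e / C).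
have s0 : 0 < s by rewrite lt_min ltr01 divr_gt0.
have s1 : s <= 1 by rewrite ge_min lexx.
have sC : s * C <= e by rewrite -ler_pdivlMr// ge_min lexx orbT.
have [w [_ wlt philt]] := near_lam (s ^+ 2) (exprn_gt0 _ s0).
apply: (le_trans (ltW philt)); rewrite lee_fin.
have young : - dotv eta (w - lam) <= s * (dotv eta eta + 1).
  have := dotv_young eta (w - lam) (- s); move: wlt (dotvv_ge0 eta).
  set p := dotv eta _; set q := dotv (w - lam) _; set N := dotv eta eta.
  move=> q_lt N0 h; rewrite -(ler_pM2l s0); nra.
have : (b - a) * (mu / 2) * s ^+ 2 <= (b - a) * (mu / 2) * s.
  by rewrite ler_pM2l// expr2 ger_pMr.
by move: sC young; rewrite /C; lra.
Qed.

Theorem proposition2 (R : realType) (nx nu nl ng : nat)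
  (g : 'cV[R]_nl -> 'cV[R]_ng)
  (F : 'cV[R]_nx -> 'cV[R]_nu -> 'cV[R]_nl -> 'cV[R]_nl)
  (d : 'cV[R]_nl -> R) (c a b : R)
  (K := nonneg_set g)
  (K_nonempty : K !=set0)
  (K_closed : closed K)
  (K_convex : convex_set (K : set (convex_lmodType 'cV[R]_nl)))
  (g_C1 : C1 g)
  (g_concave : forall i, concave (fun lam => g lam i 0))
  (g_LICQ : forall lam, K lam -> LICQ g lam)
  (F_LC2 : LC 2 (fun z : 'cV[R]_(nx + nu + nl) =>
    F (usubmx (usubmx z)) (dsubmx (usubmx z)) (dsubmx z)))
  (d_strongly_convex : strongly_convex d)
  (d_LC3 : LC 3 (fun lam => (d lam)%:M : 'cV[R]_1))
  (c_gt0 : 0 < c) (a_gt0 : 0 < a) (a_lt_b : a < b)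
  (x : 'cV[R]_nx) (u : 'cV[R]_nu) (lam : 'cV[R]_nl) :
  let S1 := SOL K (F x u) lam in
  let S2 := exists eta : 'cV[R]_nl,
    [/\ F x u lam - eta = 0,
        forall i, 0 <= g lam i 0 &
        (phi_Au K d c lam eta <= 0)%E] in
  let S3 := exists eta : 'cV[R]_nl,
    F x u lam - eta = 0 /\ (phi_Au_ab K d a b lam eta <= 0)%E in
  (S1 <-> S2) /\ (S2 <-> S3).
Proof.
move=> S1 S2 S3.
have dd : differentiable d lam := LC_differentiable lam d_LC3.
have [mu mu0 dsc] := d_strongly_convex.
have dge omega := @bregman_ge _ _ d mu lam omega dd dsc.
have dge0 omega : 0 <= bregman d lam omega.
  apply: le_trans (dge omega).
  by rewrite mulr_ge0 ?dotvv_ge0// divr_ge0 ?ltW.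
have b_gt0 : 0 < b := lt_trans a_gt0 a_lt_b.
have S1_phi k : 0 < k -> S1 -> (phi_Au K d k lam (F x u lam) <= 0)%E.
  move=> k0 [_ vi]; apply: VI_phi_Au_le0 => // w Kw.
  by rewrite dotvC; exact: vi.
have phi_S1 k : 0 < k -> K lam ->
    (phi_Au K d k lam (F x u lam) <= 0)%E -> S1.
  move=> k0 Kl phi0; split=> // w Kw.
  by rewrite dotvC; exact: (phi_Au_le0_VI k0 dd K_convex Kl phi0).
have S12 : S1 <-> S2.
  split=> [s1|[eta [/subr0_eq <- Kl phi0]]]; last exact: (phi_S1 c).
  by exists (F x u lam); rewrite subrr; split=> //; [case: s1|exact: S1_phi].
split=> //; rewrite -S12; split=> [s1|[eta [/subr0_eq <-]]].
  exists (F x u lam); rewrite subrr; split=> //.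
  (* At a solution both gap functions vanish, since [omega = lam] gives the value 0. *)
  have phi_eq0 k : 0 < k -> phi_Au K d k lam (F x u lam) = 0%E.
    move=> k0; apply/eqP; rewrite eq_le S1_phi//=.
    by apply: phi_Au_ge0; case: s1.
  by rewrite /phi_Au_ab !phi_eq0// sube0.
(* The D-gap condition yields the primal gap condition with [b] in place of [c], and [phi_S1] holds
   for every positive parameter. *)
move=> /(phi_Au_ab_le0 K_nonempty K_closed b_gt0 a_lt_b mu0 dge)[Kl].
exact: phi_S1.
Qed.
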